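(* Let $\{G_n\}_{n\ge0}$ be a Gibonacci sequence and let $\{G'_n\}_{n\ge0}$ be the associated modified Gibonacci sequence. For all integers $n\geq 2$, $$(G_0G_n+G_1G_{n-1}-G_1G'_{n-2})\,G_{n-1}=(G_1G'_n+G_0G'_{n-1}-G_0G_{n-2})\,G'_{n-1}.$$
   Context: A Gibonacci sequence is a sequence satisfying $G_n=G_{n-1}+G_{n-2}$ for $n\ge2$, with initial values $G_0,G_1$ chosen freely (here arbitrary integers). The associated modified Gibonacci sequence is defined by $G'_0=G_1$, $G'_1=G_0$ and $G'_n=G'_{n-1}+G'_{n-2}$ for $n\ge 2$. *)

(* Defs.v *)
From mathcomp Require Import all_boot all_order all_algebra.

Set Implicit Arguments.
Unset Strict Implicit.
Unset Printing Implicit Defensive.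

Import GRing.Theory.
Local Open Scope ring_scope.

(* The initial values [G 0] and [G 1] are unconstrained. *)
Definition gibonacci (G : nat -> int) : Prop :=
  forall n : nat, (2 <= n)%N -> G n = G (n - 1)%N + G (n - 2)%N.

(* [G'] starts from the initial values of [G] in swapped order. *)
Definition modified_gibonacci (G G' : nat -> int) : Prop :=
  [/\ G' 0%N = G 1%N, G' 1%N = G 0%N & gibonacci G'].

(* Main.v *)
Require Import Defs.
From mathcomp Require Import all_boot all_order all_algebra.
From mathcomp Require Import ring.

Import GRing.Theory.
Local Open Scope ring_scope.

(** Both sides equal [(G 0 + G 1) * G (n - 1) * G' (n - 1)].  The first factor
    on the left is [(G 0 + G 1) * G' (n - 1)]
    ([modified_gibonacci_linear_relation]): this relation is linear in [G] and
    [G'] with coefficients that do not depend on the index, so both of its sides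
    satisfy the Gibonacci recurrence and it is enough to compare their first
    two values.  Swapping the initial values is an involution
    ([modified_gibonacci_sym]), so exchanging the roles of [G] and [G'] shows
    that the first factor on the right is [(G 0 + G 1) * G (n - 1)]. *)

Lemma gibonacciSS {G : nat -> int} (m : nat) :
  gibonacci G -> G m.+2 = G m.+1 + G m.
Proof. by move=> hG; rewrite (hG m.+2) // subSS subn0 subn2. Qed.

Lemma modified_gibonacci_sym {G G' : nat -> int} :
  gibonacci G -> modified_gibonacci G G' -> modified_gibonacci G' G.
Proof. by move=> hG [G'0 G'1 _]; split. Qed.

Lemma gibonacci_ext {G H : nat -> int} :
  gibonacci G -> gibonacci H -> G 0%N = H 0%N -> G 1%N = H 1%N ->
  forall m, G m = H m.
Proof.
move=> hG hH e0 e1 m.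
suff [] : G m = H m /\ G m.+1 = H m.+1 by [].
elim: m => [//|m [em emS]]; split=> //.
by rewrite (gibonacciSS m hG) (gibonacciSS m hH) em emS.
Qed.

(** With [a = G 0] and [b = G 1], the two initial comparisons are
    [a (a + b) + b b - b b = (a + b) a] and
    [a (a + 2 b) + b (a + b) - b a = (a + b) (a + b)]. *)
Lemma modified_gibonacci_linear_relation {G G' : nat -> int} (m : nat) :
  gibonacci G -> modified_gibonacci G G' ->
  G 0%N * G m.+2 + G 1%N * G m.+1 - G 1%N * G' m =
  (G 0%N + G 1%N) * G' m.+1.
Proof.
move=> hG [G'0 G'1 hG'].
pose lhs k := G 0%N * G k.+2 + G 1%N * G k.+1 - G 1%N * G' k.
pose rhs k := (G 0%N + G 1%N) * G' k.+1.
apply: (@gibonacci_ext lhs rhs).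
- case=> [|[|k]] // _; rewrite /lhs !subSS !subn0.
  rewrite (gibonacciSS k.+2 hG) (gibonacciSS k.+1 hG) (gibonacciSS k hG').
  by rewrite (gibonacciSS k hG); ring.
- case=> [|[|k]] // _; rewrite /rhs !subSS !subn0.
  by rewrite (gibonacciSS k.+1 hG'); ring.
- by rewrite /lhs /rhs (gibonacciSS 0 hG) G'0 G'1; ring.
- rewrite /lhs /rhs (gibonacciSS 1 hG) (gibonacciSS 0 hG).
  by rewrite (gibonacciSS 0 hG') G'0 G'1; ring.
Qed.

Theorem mainTheorem10 (G G' : nat -> int)
    (hG : gibonacci G) (hG' : modified_gibonacci G G')
    (n : nat) (hn : (2 <= n)%N) :
  (G 0%N * G n + G 1%N * G (n - 1)%N - G 1%N * G' (n - 2)%N) * G (n - 1)%N =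
  (G 1%N * G' n + G 0%N * G' (n - 1)%N - G 0%N * G (n - 2)%N) * G' (n - 1)%N.
Proof.
case: n hn => [|[|m]] // _; rewrite !subSS !subn0.
have [G'0 G'1 hgG'] := hG'.
rewrite (modified_gibonacci_linear_relation m hG hG').
have := modified_gibonacci_linear_relation m hgG' (modified_gibonacci_sym hG hG').
by rewrite G'0 G'1 => ->; ring.
Qed.
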